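(* Let $n\ge 2$, $m\ge 1$, let $R$ be a dominant region of the $m$-Shi arrangement with $m$-minimal alcove $\mathcal A$, and let $\lambda$ be the $n$-core with $\Psi(\lambda)=\mathcal A$. Then $H_{\theta,m}$ is a separating wall for $R$ if and only if $h^\lambda_{11}=n(m-1)+1$, where $h^\lambda_{11}$ is the hook length of the box $(1,1)$ of $\lambda$.
   Context: Let $e_1,\dots,e_n$ be the standard basis of $\mathbb R^n$ with the standard inner product $\langle\cdot,\cdot\rangle$, and $V=\{(a_1,\dots,a_n)\in\mathbb R^n:\sum_i a_i=0\}$. For $1\le i\le j\le n-1$ let $\alpha_{ij}=e_i-e_{j+1}$, $\alpha_i=\alpha_{ii}$, $\Delta^+=\{\alpha_{ij}\}$, and $\theta=\alpha_{1,n-1}$. For $\alpha\in\Delta^+$, $k\in\mathbb Z$, let $H_{\alpha,k}=\{v\in V:\langle v,\alpha\rangle=k\}$. The $m$-Shi arrangement is $\{H_{\alpha,k}:\alpha\in\Delta^+,\,-m<k\le m\}$; its regions are the connected components of the complement in $V$ of the union of its hyperplanes, and a region is dominant if it lies in the dominant chamber $\{v\in V:\langle v,\alpha_i\rangle\ge0\ \forall i\}$. Alcoves are the connected components of $V\setminus\bigcup_{\alpha\in\Delta^+,k\in\mathbb Z}H_{\alpha,k}$; the fundamental alcove $A_0$ is the interior of $\{v\in V:\langle v,\theta\rangle\le1,\ \langle v,\alpha_i\rangle\ge0\ \forall i\}$. Each region contains a unique alcove separated from $A_0$ by the fewest hyperplanes $H_{\alpha,k}$ ($\alpha\in\Delta^+,k\in\mathbb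 Z$), its $m$-minimal alcove. A wall of a region $R$ is a hyperplane of the $m$-Shi arrangement supporting a facet of $R$; it is a separating wall if $R$ and $A_0$ lie in different closed half-spaces determined by it. For an alcove $\mathcal A$, its Shi coordinates are the integers $k_{ij}$ ($1\le i\le j\le n-1$) with $k_{ij}<\langle x,\alpha_{ij}\rangle<k_{ij}+1$ for all $x\in\mathcal A$; an alcove is determined by them. An $n$-core is a partition with no hook length divisible by $n$. For an $n$-core $\lambda$ with $\ell(\lambda)$ positive parts, let $B=\{h^\lambda_{k1}:1\le k\le\ell(\lambda)\}\cup\mathbb Z_{<0}$ and for $0\le i\le n-1$ let the level number $b_i$ be the least integer $q$ with $qn+i\notin B$. Put $\tilde p_i=b_{i-1}n+i-1$ ($1\le i\le n$), let $p_1<\dots<p_n$ be these in increasing order, and let $\Psi(\lambda)$ be the alcove with Shi coordinates $k_{ij}=\lfloor(p_{j+1}-p_i)/n\rfloor$. The map $\Psi$ is a bijection from $n$-cores onto dominant alcoves. *)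

(* Defs.v *)
From HB Require Import structures.
From mathcomp Require Export all_boot all_order all_algebra.
From mathcomp Require Export all_classical all_reals all_analysis.

Export Order.TTheory GRing.Theory Num.Theory.
Export numFieldNormedType.Exports.

#[export] Set Implicit Arguments.
#[export] Unset Strict Implicit.
#[export] Unset Printing Implicit Defensive.

Local Open Scope classical_set_scope.
Local Open Scope ring_scope.

(* All indices i, j, k of basis vectors, roots, parts and boxes are 1-based
   natural numbers. *)

Definition dot (K : realType) (n : nat) (u v : 'rV[K]_n) : K :=
  \sum_k u 0 k * v 0 k.

Definition basisv (K : realType) (n i : nat) : 'rV[K]_n :=
  \row_(k < n) (k.+1 == i)%:R.

Definition V (K : realType) (n : nat) : set 'rV[K]_n :=
  [set v | \sum_k v 0 k = 0].

Definition alpha (K : realType) (n i j : nat) : 'rV[K]_n :=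
  basisv K n i - basisv K n j.+1.

Definition theta (K : realType) (n : nat) : 'rV[K]_n := alpha K n 1 n.-1.

Definition Delta_plus (K : realType) (n : nat) : set 'rV[K]_n :=
  [set a | exists i j : nat, (1 <= i <= j)%N && (j <= n.-1)%N
                             /\ a = alpha K n i j].

Definition Hyp (K : realType) (n : nat) (a : 'rV[K]_n) (k : int) :
    set 'rV[K]_n :=
  [set v | V v /\ dot v a = k%:~R].

Definition half_le (K : realType) (n : nat) (a : 'rV[K]_n) (k : int) :
    set 'rV[K]_n :=
  [set v | V v /\ dot v a <= k%:~R].

Definition half_ge (K : realType) (n : nat) (a : 'rV[K]_n) (k : int) :
    set 'rV[K]_n :=
  [set v | V v /\ k%:~R <= dot v a].

Definition all_hyps (K : realType) (n : nat) : set (set 'rV[K]_n) :=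
  [set H | exists (a : 'rV[K]_n) (k : int),
    Delta_plus a /\ H = Hyp a k].

Definition shi (K : realType) (n m : nat) : set (set 'rV[K]_n) :=
  [set H | exists (a : 'rV[K]_n) (k : int),
    [/\ Delta_plus a, - m%:Z < k <= m%:Z & H = Hyp a k]].

(* Connectedness of a subset of V is intrinsic, so the components may be taken
   in the ambient space. *)
Definition component_of (K : realType) (n : nat)
    (Hs : set (set 'rV[K]_n)) (C : set 'rV[K]_n) : Prop :=
  let compl := @V K n `\` \bigcup_(H in Hs) H in
  exists2 x, compl x & C = connected_component compl x.

Definition is_region (K : realType) (n m : nat) (C : set 'rV[K]_n) : Prop :=
  component_of (@shi K n m) C.

Definition is_alcove (K : realType) (n : nat) (C : set 'rV[K]_n) : Prop :=
  component_of (@all_hyps K n) C.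

Definition dominant_chamber (K : realType) (n : nat) : set 'rV[K]_n :=
  [set v | V v /\
    forall i : nat, (1 <= i <= n.-1)%N -> 0 <= dot v (alpha K n i i)].

Definition dominant_region (K : realType) (n m : nat) (C : set 'rV[K]_n) :
    Prop :=
  is_region m C /\ C `<=` @dominant_chamber K n.

(* The interior is relative to V: it would be empty in the ambient space. *)
Definition A0 (K : realType) (n : nat) : set 'rV[K]_n :=
  @interior (subspace (@V K n))
    [set v | dominant_chamber v /\ dot v (theta K n) <= 1].

Definition separates (K : realType) (n : nat) (a : 'rV[K]_n) (k : int)
    (X Y : set 'rV[K]_n) : Prop :=
  (X `<=` half_le a k /\ Y `<=` half_ge a k) \/
  (X `<=` half_ge a k /\ Y `<=` half_le a k).

Definition sep_hyps (K : realType) (n : nat) (X Y : set 'rV[K]_n) :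
    set (set 'rV[K]_n) :=
  [set H | exists (a : 'rV[K]_n) (k : int),
    [/\ Delta_plus a, H = Hyp a k & separates a k X Y]].

Definition minimal_alcove (K : realType) (n : nat) (C A : set 'rV[K]_n) :
    Prop :=
  [/\ is_alcove A, A `<=` C &
    forall A', is_alcove A' -> A' `<=` C ->
      (sep_hyps A (@A0 K n) #<= sep_hyps A' (@A0 K n))%card].

Definition aff_indep (K : realType) (n d : nat) (x : 'I_d.+1 -> 'rV[K]_n) :
    Prop :=
  row_free (\matrix_(i < d) (x (lift ord0 i) - x ord0)).

Definition has_affine_dim (K : realType) (n : nat) (S : set 'rV[K]_n)
    (d : nat) : Prop :=
  (exists2 x : 'I_d.+1 -> 'rV[K]_n, (forall i, S (x i)) & aff_indep x) /\
  ~ (exists2 x : 'I_d.+2 -> 'rV[K]_n, (forall i, S (x i)) & aff_indep x).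

(* A facet has codimension 1 in V, i.e. dimension n - 2. *)
Definition supports_facet (K : realType) (n : nat) (a : 'rV[K]_n) (k : int)
    (C : set 'rV[K]_n) : Prop :=
  (C `<=` half_le a k \/ C `<=` half_ge a k) /\
  has_affine_dim (closure C `&` Hyp a k) n.-2.

Definition is_wall (K : realType) (n m : nat) (C : set 'rV[K]_n)
    (a : 'rV[K]_n) (k : int) : Prop :=
  [/\ Delta_plus a, - m%:Z < k <= m%:Z & supports_facet a k C].

Definition separating_wall (K : realType) (n m : nat) (C : set 'rV[K]_n)
    (a : 'rV[K]_n) (k : int) : Prop :=
  is_wall m C a k /\ separates a k C (@A0 K n).

Definition shi_coords (K : realType) (n : nat) (A : set 'rV[K]_n)
    (k : nat -> nat -> int) : Prop :=
  forall i j : nat, (1 <= i <= j)%N && (j <= n.-1)%N ->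
    forall x, A x ->
      (k i j)%:~R < dot x (alpha K n i j) < (k i j)%:~R + 1.

Definition is_partition (la : seq nat) : bool :=
  sorted geq la && (0%N \notin la).

Definition part (la : seq nat) (k : nat) : nat := nth 0%N la k.-1.

Definition conj_part (la : seq nat) (j : nat) : nat :=
  count (fun p => (j <= p)%N) la.

Definition in_diagram (la : seq nat) (k j : nat) : bool :=
  (1 <= k <= size la)%N && (1 <= j <= part la k)%N.

(* The value outside the diagram is 0, which is the length of no hook; in
   particular h_11 = 0 for the empty partition. *)
Definition hook (la : seq nat) (k j : nat) : nat :=
  if in_diagram la k j then ((part la k - j) + (conj_part la j - k)).+1
  else 0%N.

Definition is_core (n : nat) (la : seq nat) : Prop :=
  is_partition la /\
  forall k j : nat, in_diagram la k j -> ~~ (n %| hook la k j)%N.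

Definition beads (la : seq nat) : set int :=
  [set z | (exists2 k : nat, (1 <= k <= size la)%N & z = (hook la k 1)%:Z)
           \/ z < 0].

Definition level (n : nat) (la : seq nat) (i : nat) : int :=
  xget 0 [set b : int | ~ beads la (b * n%:Z + i%:Z) /\
    forall q : int, ~ beads la (q * n%:Z + i%:Z) -> b <= q].

Definition ptilde (n : nat) (la : seq nat) (i : nat) : int :=
  level n la i.-1 * n%:Z + i.-1%:Z.

Definition psorted (n : nat) (la : seq nat) (i : nat) : int :=
  nth 0 (sort (fun x y : int => x <= y)
              [seq ptilde n la l | l <- iota 1 n]) i.-1.

Definition Psi_coords (n : nat) (la : seq nat) (i j : nat) : int :=
  ((psorted n la j.+1 - psorted n la i) %/ n%:Z)%Z.

(* Psi(la) = A *)
Definition Psi_eq (K : realType) (n : nat) (la : seq nat)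
    (A : set 'rV[K]_n) : Prop :=
  is_alcove A /\ shi_coords A (Psi_coords n la).

(* Main.v *)
From mathcomp Require Import perm zify ring lra.
Require Import Defs.

Local Open Scope classical_set_scope.
Local Open Scope ring_scope.

(** The first gaps [p_1 < ... < p_n] of the runners are the window of the alcove
    [A]: they represent every residue modulo [n], [p_1 = 0], and, since a core is
    flush, [p_n = h_11 + n].  So [h_11 = n (m - 1) + 1] means [p_n = n m + 1].

    Write [p_a = n c_a + r_a] with [0 <= r_a < n].  The alcove is cut out by
    [c_b - c_a < v_a - v_b < c_b - c_a + 1] over all [r_a < r_b], so if
    [p_n = n m + 1] then [theta = m] bounds [A], and hence the region, along a
    facet.

    Conversely, on the region [v_a - v_b > c_b - c_a] whenever [r_a < r_b] and
    [|c_b - c_a| <= m].  Minimality of [A] forces [c_b - c_a <= m] for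
    consecutive ranks; chaining the inequalities along the successive suffix
    minima of [c] gives [theta > c_n] on the region.  A separating wall at
    [theta = m] therefore has [c_n = m].  If [r_n >= 2], the element [u] of rank
    [1] satisfies [v_1 - v_u > c_u] and [v_u - v_n > m - c_u], so the closure of
    the region meets [theta = m] in codimension at least two. *)

(** * Beads and window of a core *)

Lemma conj_part1 (la : seq nat) : 0%N \notin la -> conj_part la 1 = size la.
Proof.
move=> la0; apply/eqP; rewrite -all_count; apply/allP => p pla.
by rewrite lt0n; apply: contraNneq la0 => <-.
Qed.

Lemma mem_part (la : seq nat) k : (1 <= k <= size la)%N -> part la k \in la.
Proof. by case/andP=> k1 kla; apply: mem_nth; rewrite prednK. Qed.

Lemma hook_col1 (la : seq nat) k : is_partition la -> (1 <= k <= size la)%N ->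
  hook la k 1 = (part la k + size la - k)%N.
Proof.
move=> /andP[_ la0] kla; rewrite /hook /in_diagram kla /=.
have pk : (0 < part la k)%N.
  have : part la k \in la by exact: mem_part.
  by rewrite lt0n; apply: contraTneq => ->.
rewrite conj_part1 // pk /=; lia.
Qed.

Lemma hook_row1 (la : seq nat) j : la != [::] -> (1 <= j <= part la 1)%N ->
  hook la 1 j = (part la 1 + conj_part la j - j)%N.
Proof.
case: la => // q s _ jla; rewrite /hook /in_diagram jla /=.
have jq : (j <= q)%N by case/andP: jla.
have : (0 < conj_part (q :: s) j)%N by rewrite /conj_part /= jq.
lia.
Qed.

(* With [s] the tail of [la], the first-column hooks of [la] are those of [s]
   together with [part la 1 + size s], which drives the induction. *)
Lemma gap_row1 (la : seq nat) g : is_partition la ->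
  (g < part la 1 + (size la).-1)%N ->
  (exists2 k, (1 <= k <= size la)%N & g = (part la k + size la - k)%N) \/
  (exists2 j, (1 <= j <= part la 1)%N &
     (g + conj_part la j).+1 = (j + size la)%N).
Proof.
elim: la g => [|q s IHs] g //; rewrite /is_partition /= inE negb_or.
case/andP=> qs /andP[q0 s0]; rewrite /part /= => gq.
case: s => [|q' s'] in IHs qs s0 gq *.
  move: gq => /= gq; right; exists g.+1; first by lia.
  by rewrite /conj_part /=; lia.
have ps : is_partition (q' :: s').
  by rewrite /is_partition s0 andbT; move: qs => /= /andP[].
have q'q : (q' <= q)%N by move: qs => /= /andP[].
move: gq; rewrite /= => gq.
have [gq'|gq'|gq'] := ltngtP g (q' + size s')%N.
- have [|[k kP gk]|[j jP gj]] := IHs g ps; first by rewrite /part /=.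
    left; exists k.+1; first by move: kP => /=; lia.
    by rewrite gk /part /=; case: k kP {gk} => //= k; lia.
  right; exists j; first by move: jP; rewrite /part /=; lia.
  move: gj jP; rewrite /conj_part /part /=; lia.
(* Here [g] lies strictly between the first two hooks, so the column [g - size s'] is longer than
   [q'] and only the first row reaches it. *)
- right; exists (g - size s')%N; first lia.
  have c0 : count (leq (g - size s')) (q' :: s') = 0%N.
    apply/eqP; rewrite -leqn0 leqNgt -has_count; apply/hasPn => z zs.
    have : (z <= q')%N.
      move: zs; rewrite inE => /orP[/eqP->//|zs'].
      have : path geq q' s' by case/andP: qs.
      rewrite path_sortedE; last by move=> a b c /=; lia.
      by case/andP=> /allP/(_ _ zs').
    lia.
  rewrite /conj_part.
  change ((g + ((g - size s' <= q) + count (leq (g - size s')) (q' :: s'))).+1 =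
    (g - size s' + (size s').+2)%N).
  rewrite c0; lia.
- by left; exists 2%N => //=; rewrite gq'; lia.
Qed.

Lemma part_le1 (la : seq nat) k : is_partition la -> (1 <= k <= size la)%N ->
  (part la k <= part la 1)%N.
Proof.
case: la => [|q s] /=; first lia.
case/andP=> qs _ kP; rewrite /part /=.
have : all (geq q) (q :: s).
  rewrite /= leqnn /=; move: qs => /=.
  rewrite path_sortedE; last by move=> a b c /=; lia.
  by case/andP.
by move/allP; apply; exact: (@mem_part (q :: s)).
Qed.

Section Core.
Variables (n : nat) (la : seq nat).
Hypotheses (n1 : (1 < n)%N) (la_core : is_core n la).
Let h := hook la 1 1.

Lemma beads_le z : la != [::] -> beads la z -> z <= h%:Z.
Proof.
have [pla _] := la_core; move=> la0 [[k kP ->]|]; last lia.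
have s1 : (0 < size la)%N by case: la la0.
have := part_le1 pla kP.
rewrite /h !hook_col1 //; lia.
Qed.

Lemma beads_hook11 : la != [::] -> beads la h%:Z.
Proof. by move=> la0; left; exists 1%N => //; case: la la0. Qed.

Lemma beads0 : ~ beads la 0.
Proof.
have [pla _] := la_core; case=> // -[k kP]; rewrite hook_col1 // => e.
have : part la k \in la by exact: mem_part.
case/andP: pla => _ /negP nla; suff -> : part la k = 0%N by [].
lia.
Qed.

(* A gap at distance [j n] below [h_11] would be a hook of length [j n] in the
   first row. *)
Lemma gap_runner z : la != [::] -> ~ beads la z -> (n%:Z %| h%:Z - z)%Z ->
  h%:Z + n%:Z <= z.
Proof.
move=> la0 zB nz; have [pla hookP] := la_core.
have s1 : (0 < size la)%N by case: la la0.
have z0 : 0 <= z by rewrite leNgt; apply/negP => zlt; apply: zB; right.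
have zh : z != h%:Z by apply: contra_notN zB => /eqP ->; exact: beads_hook11.
have [hz|hz] := boolP (h%:Z < z).
  case/dvdzP: nz => q hzq; have : q < 0 by nia.
  nia.
exfalso; case: z z0 => // g _ in zB nz zh hz *.
have gh : (g < h)%N by lia.
have hE : h = (part la 1 + (size la).-1)%N by rewrite /h hook_col1 //; lia.
have [|[k kP gk]|[j jP gj]] := gap_row1 pla (g := g); first by rewrite -hE.
  by apply: zB; left; exists k => //; rewrite gk hook_col1.
have /negP[] : ~~ (n %| hook la 1 j)%N.
  by apply: hookP; rewrite /in_diagram jP andbT; lia.
(* The equation for [j] amounts to [hook la 1 j = h - g], which [n] divides. *)
rewrite hook_row1 //; move: nz; rewrite dvdzE.
have -> : `|h%:Z - g%:Z|%N = (part la 1 + conj_part la j - j)%N by lia.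
by [].
Qed.

(** The [xget] in [level] finds a genuine minimum: negative integers are beads, so the gaps of a
    runner are bounded below, and no bead exceeds [h], so gaps exist. *)
Lemma level_spec i : (i < n)%N ->
  [/\ 0 <= level n la i, ~ beads la (level n la i * n%:Z + i%:Z) &
      forall q, ~ beads la (q * n%:Z + i%:Z) -> level n la i <= q].
Proof.
move=> ni; set S := [set b : int | ~ beads la (b * n%:Z + i%:Z) /\
    forall q : int, ~ beads la (q * n%:Z + i%:Z) -> b <= q].
have pos q : ~ beads la (q * n%:Z + i%:Z) -> 0 <= q.
  by move=> qB; rewrite leNgt; apply/negP => q0; apply: qB; right; nia.
have [b Sb] : exists b, S b.
  have ex : exists q : nat, `[< ~ beads la (q%:Z * n%:Z + i%:Z) >].
    exists h.+1; apply/asboolP; have [la0|la0] := eqVneq la [::].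
      by rewrite la0 => -[[k /=]|]; lia.
    by move=> /(beads_le la0); nia.
  exists (ex_minn ex)%:Z; case: ex_minnP => q /asboolP qB qmin; split=> // q' q'B.
  have := pos _ q'B; case: q' q'B => // q' q'B _.
  by rewrite lez_nat; apply: qmin; apply/asboolP.
have [lB lmin] : S (level n la i) by exact: (@xgetPex _ 0 S (ex_intro _ b Sb)).
by split=> //; exact: pos.
Qed.

Lemma ptilde_ge0 l : (1 <= l <= n)%N -> 0 <= ptilde n la l.
Proof.
by move=> ln; have [|l0 _ _] := @level_spec l.-1; [lia|rewrite /ptilde; nia].
Qed.

Lemma ptilde1 : ptilde n la 1 = 0.
Proof.
have [|l0 _ lmin] := @level_spec 0; first lia.
have : level n la 0 <= 0 by apply: lmin; rewrite mul0r add0r; exact: beads0.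
by rewrite /ptilde /=; nia.
Qed.

(** Otherwise the level could be lowered by one. *)
Lemma ptilde_bead l : (1 <= l <= n)%N -> beads la (ptilde n la l - n%:Z).
Proof.
move=> ln; have [|l0 _ lmin] := @level_spec l.-1; first lia.
apply: contrapT => nb; have := lmin (level n la l.-1 - 1).
have -> : (level n la l.-1 - 1) * n%:Z + l.-1%:Z = ptilde n la l - n%:Z.
  by rewrite /ptilde; ring.
by move/(_ nb); lia.
Qed.

Lemma ptilde_max_nil l : la = [::] -> (1 <= l <= n)%N -> ptilde n la l < n%:Z.
Proof.
by move=> la0 /ptilde_bead; rewrite la0 => -[[k /=]|]; lia.
Qed.

Lemma ptilde_max l : la != [::] -> (1 <= l <= n)%N ->
  ptilde n la l <= h%:Z + n%:Z.
Proof. by move=> la0 /ptilde_bead/(beads_le la0); lia. Qed.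

(** The runner of the largest bead [h] is flush, so its first gap comes one step after [h]. *)
Lemma ptilde_max_attained : la != [::] ->
  ptilde n la (h %% n).+1 = h%:Z + n%:Z.
Proof.
move=> la0; have hn : (h %% n < n)%N by rewrite ltn_mod; lia.
apply/eqP; rewrite eq_le ptilde_max //=.
have [_ lB _] := level_spec hn; apply: (gap_runner la0 lB).
apply/dvdzP; exists ((h %/ n)%N%:Z - level n la (h %% n)).
have := divn_eq h n; lia.
Qed.

(** The window with 0-based indices: [psorted n la i] is its entry [i.-1]. *)
Definition pseq :=
  sort (fun x y : int => x <= y) [seq ptilde n la l | l <- iota 1 n].

Lemma size_pseq : size pseq = n.
Proof. by rewrite size_sort size_map size_iota. Qed.

Lemma mem_pseq z : z \in pseq -> exists2 l, (1 <= l <= n)%N & z = ptilde n la l.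
Proof.
by rewrite mem_sort => /mapP[l]; rewrite mem_iota => lP ->; exists l => //; lia.
Qed.

Lemma ptilde_mod l : (1 <= l <= n)%N -> (ptilde n la l %% n%:Z)%Z = l.-1%:Z.
Proof.
by move=> lP; rewrite /ptilde modzMDl modz_small //; lia.
Qed.

Lemma uniq_pseq_mod : uniq [seq (z %% n%:Z)%Z | z <- pseq].
Proof.
rewrite (perm_uniq (perm_map _ (permEl (perm_sort _ _)))) -map_comp.
rewrite map_inj_in_uniq ?iota_uniq // => k l; rewrite !mem_iota => kP lP /=.
rewrite !ptilde_mod; lia.
Qed.

Lemma nth_pseq_mod_inj i j : (i < n)%N -> (j < n)%N ->
  (nth 0 pseq i %% n%:Z)%Z = (nth 0 pseq j %% n%:Z)%Z -> i = j.
Proof.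
move=> ni nj e; apply/eqP.
rewrite -(nth_uniq 0 _ _ uniq_pseq_mod) ?size_map ?size_pseq //.
by rewrite !(nth_map 0) ?size_pseq // e.
Qed.

Lemma nth_pseq_lt i j : (i < j < n)%N -> nth 0 pseq i < nth 0 pseq j.
Proof.
move=> ij; rewrite lt_neqAle; apply/andP; split.
  by apply/eqP => e; have := @nth_pseq_mod_inj i j; rewrite e; lia.
apply: (sorted_leq_nth le_trans le_refl); rewrite ?inE ?size_pseq; try lia.
exact: sort_le_sorted.
Qed.

Lemma nth_pseq0 : nth 0 pseq 0 = 0.
Proof.
have : 0 \in pseq.
  by rewrite mem_sort -ptilde1; apply: map_f; rewrite mem_iota; lia.
case/(nthP 0) => i; rewrite size_pseq => ni i0.
have : nth 0 pseq 0 \in pseq by apply: mem_nth; rewrite size_pseq; lia.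
case/mem_pseq => l lP e; have := ptilde_ge0 lP; rewrite -e.
case: i => // i in ni i0 *; have : nth 0 pseq 0 < nth 0 pseq i.+1.
  by apply: nth_pseq_lt; lia.
by rewrite i0 => /lt_geF ->.
Qed.

Lemma nth_pseq_last_nil : la = [::] -> nth 0 pseq n.-1 < n%:Z.
Proof.
move=> la0; have : nth 0 pseq n.-1 \in pseq.
  by apply: mem_nth; rewrite size_pseq; lia.
by case/mem_pseq => l lP ->; exact: ptilde_max_nil.
Qed.

Lemma nth_pseq_last : la != [::] -> nth 0 pseq n.-1 = h%:Z + n%:Z.
Proof.
move=> la0; have : nth 0 pseq n.-1 \in pseq.
  by apply: mem_nth; rewrite size_pseq; lia.
case/mem_pseq => l lP e; apply/eqP; rewrite eq_le {1}e ptilde_max //=.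
have hn : (h %% n < n)%N by rewrite ltn_mod; lia.
have : ptilde n la (h %% n).+1 \in pseq.
  by rewrite mem_sort; apply: map_f; rewrite mem_iota; lia.
rewrite ptilde_max_attained //; case/(nthP 0) => i; rewrite size_pseq => ni <-.
have [->//|ne] := eqVneq i n.-1; apply: ltW; apply: nth_pseq_lt; lia.
Qed.

Lemma nth_pseq_last_hook (m : nat) : (0 < m)%N ->
  nth 0 pseq n.-1 = (n * m + 1)%N%:Z <-> h = (n * (m - 1) + 1)%N.
Proof.
(* For the empty partition both sides fail: the window stays below [n], and [h] takes the default
   value 0. *)
move=> m0; have [la0|la0] := eqVneq la [::].
  have := nth_pseq_last_nil la0; have -> : h = 0%N by rewrite /h la0.
  by split; nia.
by rewrite nth_pseq_last //; case: m m0 => // m _; rewrite subn1 /= mulnS; lia.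
Qed.

End Core.

(** * Cells of a subarrangement *)

Section Arrangement.
Variables (K : realType) (n : nat).
Implicit Types (x y v : 'rV[K]_n) (a b : 'I_n) (P : set int).

(** Only the first index needs a successor to become 1-based, since [alpha] shifts its second index
    itself. *)
Lemma dot_alpha v a b : dot v (alpha K n a.+1 b) = v 0 a - v 0 b.
Proof.
rewrite /dot /alpha /basisv.
under eq_bigr do rewrite !mxE mulrBr !eqSS.
rewrite sumrB; congr (_ - _).
  rewrite (bigD1 a) //= eqxx mulr1 big1 ?addr0 // => i ia.
  by rewrite (_ : (i == a :> nat) = false) ?mulr0 //; exact: negbTE.
rewrite (bigD1 b) //= eqxx mulr1 big1 ?addr0 // => i ib.
by rewrite (_ : (i == b :> nat) = false) ?mulr0 //; exact: negbTE.
Qed.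

Lemma Delta_plusP (r : 'rV[K]_n) :
  Delta_plus r <-> exists a b, (a < b)%N /\ r = alpha K n a.+1 b.
Proof.
split=> [[i [j [ij ->]]]|[a [b [ab ->]]]].
  have i1 : (i.-1 < n)%N by lia.
  have jn : (j < n)%N by lia.
  exists (Ordinal i1), (Ordinal jn); split=> /=; first lia.
  by rewrite prednK //; lia.
by exists a.+1, (b : nat); split=> //; have := ltn_ord b; lia.
Qed.

(** One complement serves both arrangements: the levels [shi_range m] give regions, all integers
    give alcoves. *)
Definition off P : set 'rV[K]_n :=
  [set v | V v /\ forall a b k, (a < b)%N -> P k -> v 0 a - v 0 b != k%:~R].

Lemma off_bigcup P (Hs : set (set 'rV[K]_n)) :
  (forall H, Hs H <-> exists a b k,
     [/\ (a < b)%N, P k & H = Hyp (alpha K n a.+1 b) k]) ->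
  @V K n `\` \bigcup_(H in Hs) H = off P.
Proof.
move=> HsP; apply/seteqP; split=> v [Vv vH]; split=> //.
  move=> a b k ab Pk; apply/eqP => vk; apply: vH.
  exists (Hyp (alpha K n a.+1 b) k); first by apply/HsP; exists a, b, k.
  by split=> //; rewrite dot_alpha.
case=> H /HsP[a [b [k [ab Pk ->]]]] [_]; rewrite dot_alpha => /eqP.
by apply/negP; exact: vH.
Qed.

Definition shi_range (m : nat) : set int := [set k | - m%:Z < k <= m%:Z].

Lemma region_off (m : nat) C : is_region m C ->
  exists2 x, off (shi_range m) x &
    C = connected_component (off (shi_range m)) x.
Proof.
rewrite /is_region /component_of (off_bigcup (P := shi_range m)) // => H.
split=> [[r [k [/Delta_plusP[a [b [ab ->]]] kP ->]]]|[a [b [k [ab kP ->]]]]].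
  by exists a, b, k.
by exists (alpha K n a.+1 b), k; split=> //; apply/Delta_plusP; exists a, b.
Qed.

Lemma alcoveE C : is_alcove C <->
  exists2 x, off setT x & C = connected_component (off setT) x.
Proof.
rewrite /is_alcove /component_of (off_bigcup (P := setT)) // => H.
split=> [[r [k [/Delta_plusP[a [b [ab ->]]] ->]]]|[a [b [k [ab kP ->]]]]].
  by exists a, b, k.
by exists (alpha K n a.+1 b), k; split=> //; apply/Delta_plusP; exists a, b.
Qed.

Definition seg x y (t : K) : 'rV[K]_n := x + t *: (y - x).

Lemma segE x y t a b : seg x y t 0 a - seg x y t 0 b =
  (1 - t) * (x 0 a - x 0 b) + t * (y 0 a - y 0 b).
Proof. by rewrite !mxE; ring. Qed.

Lemma seg_V x y t : V x -> V y -> V (seg x y t).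
Proof.
rewrite /V /= => Vx Vy; rewrite /seg.
under eq_bigr do rewrite !mxE.
by rewrite big_split /= -mulr_sumr sumrB Vx Vy subr0 mulr0 addr0.
Qed.

Lemma seg_continuous x y : continuous (seg x y).
Proof.
move=> t; apply: cvgD; first exact: cvg_cst.
by apply: cvgZr_tmp; exact: cvg_id.
Qed.

Lemma coordB_continuous a b : continuous (fun v : 'rV[K]_n => v 0 a - v 0 b).
Proof.
move=> v; have cont := @coord_continuous K 1 n 0.
exact: (cvgB (cont a v) (cont b v)).
Qed.

Lemma conv_gt (t c X Y : K) : 0 <= t -> t <= 1 -> c < X -> c < Y ->
  c < (1 - t) * X + t * Y.
Proof.
move=> t0 t1 cX cY; have [->|tn0] := eqVneq t 0; first lra.
have : 0 < t * (Y - c) by rewrite mulr_gt0 ?subr_gt0 // lt_neqAle eq_sym tn0.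
have : 0 <= (1 - t) * (X - c) by rewrite mulr_ge0 ?subr_ge0 // ltW.
lra.
Qed.

Lemma conv_lt (t c X Y : K) : 0 <= t -> t <= 1 -> X < c -> Y < c ->
  (1 - t) * X + t * Y < c.
Proof.
move=> t0 t1 Xc Yc; have := @conv_gt t (- c) (- X) (- Y) t0 t1.
by rewrite !ltrN2 => /(_ Xc Yc); lra.
Qed.

(** On a connected set a coordinate difference takes an interval of values, so it cannot jump over
    an excluded level. Conversely, the segment between two points on the same sides meets no
    hyperplane. *)
Lemma componentE P x : off P x -> connected_component (off P) x =
  [set v | off P v /\ forall a b k, (a < b)%N -> P k ->
     (k%:~R < v 0 a - v 0 b) = (k%:~R < x 0 a - x 0 b)].
Proof.
move=> offx; apply/seteqP; split=> v.
  move=> xv; have offv := connected_component_sub xv; split=> // a b k ab Pk.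
  set f := (fun v : 'rV[K]_n => v 0 a - v 0 b).
  have : connected (f @` connected_component (off P) x).
    apply: connected_continuous_connected; first exact: component_connected.
    by apply: continuous_subspaceT; exact: coordB_continuous.
  move/connected_intervalP => itvf.
  have fk : ~ (f @` connected_component (off P) x) k%:~R.
    case=> w /connected_component_sub[_ offw] wk.
    by have := offw _ _ _ ab Pk; rewrite -wk eqxx.
  have fx : (f @` connected_component (off P) x) (f x).
    by exists x => //; exact: connected_component_refl.
  have fv : (f @` connected_component (off P) x) (f v) by exists v.
  change ((k%:~R < f v) = (k%:~R < f x)).
  case: (ltP _ (f v)) => kv; case: (ltP _ (f x)) => kx //; exfalso; apply: fk.
    by apply: (itvf _ _ fx fv); rewrite kx ltW.
  by apply: (itvf _ _ fv fx); rewrite kv ltW.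
case=> offv same.
suff sub : [set seg x v t | t in `[0, 1]] `<=` connected_component (off P) x.
  apply: sub; exists 1; first by rewrite /= in_itv /= ler01 lexx.
  by rewrite /seg scale1r addrC subrK.
apply: connected_component_max.
- exists 0; first by rewrite /= in_itv /= ler01 lexx.
  by rewrite /seg scale0r addr0.
- move=> _ [t /= + <-]; rewrite in_itv /= => /andP[t0 t1].
  split; first by apply: seg_V; [case: offx|case: offv].
  move=> a b k ab Pk; rewrite segE.
  have {}same := same _ _ _ ab Pk.
  have vk := offv.2 _ _ _ ab Pk; have xk := offx.2 _ _ _ ab Pk.
  set X := x 0 a - _ in same xk *; set Y := v 0 a - _ in same vk *.
  set c : K := k%:~R in same vk xk *.
  case: (ltgtP c X) same xk => // cX; case: (ltgtP c Y) vk => // cY _ _ _.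
    by rewrite gt_eqF //; exact: conv_gt.
  by rewrite lt_eqF //; exact: conv_lt.
- apply: connected_continuous_connected.
    by apply/connected_intervalP; exact: interval_is_interval.
  by apply: continuous_subspaceT; exact: seg_continuous.
Qed.

Lemma closure_ge (C : set 'rV[K]_n) a b (c : K) :
  (forall v, C v -> c <= v 0 a - v 0 b) ->
  forall v, closure C v -> c <= v 0 a - v 0 b.
Proof.
move=> Cc v Cv.
have cl : closed [set v : 'rV[K]_n | c <= v 0 a - v 0 b].
  apply: (@preimage_closed _ _ (fun v : 'rV[K]_n => v 0 a - v 0 b)
    [set z | c <= z]).
    by move=> w _; exact: coordB_continuous.
  exact: closed_ge.
exact: (cl v (closureS Cc Cv)).
Qed.

Lemma closure_seg (C : set 'rV[K]_n) x y :
  (forall t, 0 <= t < 1 -> C (seg x y t)) -> closure C y.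
Proof.
move=> Cs B; have -> : y = seg x y 1 by rewrite /seg scale1r addrC subrK.
move=> /(@seg_continuous x y 1)[e /= e0 eB].
(* This parameter lies in [0, 1[ and within [e] of 1. *)
have h0 : 0 <= 1 - Num.min 1 (e / 2) < 1.
  by rewrite subr_ge0 ge_min lexx /= ltrBlDr ltrDl lt_min ltr01 divr_gt0.
exists (seg x y (1 - Num.min 1 (e / 2))); split; first exact: Cs.
apply: eB => /=; rewrite opprB addrC subrK ger0_norm.
  by rewrite gt_min ltr_pdivrMr // ltr_pMr // ltr1n orbT.
by rewrite le_min ler01 divr_ge0 // ltW.
Qed.

End Arrangement.

(** * Integer parts, and strict inclusion of finite sets *)

Lemma divz_quot (d : nat) (q r z : int) : 0 <= r < d%:Z -> z = q * d%:Z + r ->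
  (z %/ d%:Z)%Z = q.
Proof.
by move=> rd ->; rewrite divzMDl ?divz_small ?addr0 //; lia.
Qed.

Lemma unit_itv_lt (K : realType) (k j : int) (X : K) :
  j%:~R < X < j%:~R + 1 -> (k%:~R < X) = (k <= j).
Proof.
case/andP=> jX Xj; have [kj|jk] := leP k j.
  by apply: le_lt_trans jX; rewrite ler_int.
apply/negbTE; rewrite -leNgt; apply: le_trans (ltW Xj) _.
by rewrite -[1](mulr1z 1) -intrD ler_int; lia.
Qed.

Lemma unit_itv_neq (K : realType) (k j : int) (X : K) :
  j%:~R < X < j%:~R + 1 -> X != k%:~R.
Proof.
move=> jX; apply/eqP => Xk; have := unit_itv_lt k jX; rewrite Xk ltxx => /esym kj.
case/andP: jX => _; rewrite Xk -[1](mulr1z 1) -intrD ltr_int; lia.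
Qed.

(** Adjoining [H] to the [k] elements of [S'] gives [k.+1] elements of [S], too many to inject into
    [S']. *)
Lemma card_le_proper T (S S' : set T) (H : T) :
  finite_set S' -> S' `<=` S -> S H -> ~ S' H -> ~ (S #<= S')%card.
Proof.
move=> [k S'k] S'S SH S'H SS'.
have US : S' `|` [set H] `<=` S by move=> G [/S'S//|->].
have : (S' `|` [set H] #= `I_k.+1)%card.
  apply/eq_cardSP; exists H; first by right.
  suff -> : (S' `|` [set H]) `\ H = S' by [].
  apply/seteqP; split=> [G [[]//]|G S'G]; split; first by left.
  by move=> GH; apply: S'H; rewrite -GH.
move=> /card_eqPle[_ kU].
have := card_le_trans kU (card_le_trans (subset_card_le US) SS').
move/card_le_trans; move: S'k => /card_eqPle[S'k _] /(_ _ _ S'k).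
by rewrite card_le_II ltnn.
Qed.

(** * The fundamental alcove and minimality *)

Section Geometry.
Variables (K : realType) (N : nat).
Local Notation n := N.+1.
Implicit Types (v x y : 'rV[K]_n) (a b : 'I_n).

(** The projection of [- f] to [V]; the sign turns an increasing [f] into a dominant vector. *)
Definition centered (f : 'I_n -> K) : 'rV[K]_n :=
  \row_k ((\sum_i f i) / n%:R - f k).

Lemma centered_V f : V (centered f).
Proof.
rewrite /V /=; under eq_bigr do rewrite mxE.
rewrite sumrB sumr_const card_ord -[_ / _ *+ _]mulr_natr divfK ?subrr //.
Qed.

Lemma centeredB f a b : centered f 0 a - centered f 0 b = f b - f a.
Proof. by rewrite !mxE; ring. Qed.

Lemma dominant_le v a b : dominant_chamber v -> (a <= b)%N -> v 0 b <= v 0 a.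
Proof.
move=> [_ dom]; have [d] := ubnP (b - a)%N; elim: d b => // d IHd b bd ab.
have [ltab||/val_inj->//] := ltngtP a b; last by lia.
have b1 : (b.-1 < n)%N by have := ltn_ord b; lia.
have := IHd (Ordinal b1); rewrite /= => IH.
apply: le_trans (IH _ _); [|lia..].
have := dom b; have := dot_alpha v (Ordinal b1) b; rewrite /= prednK; last lia.
by move=> -> /(_ _); rewrite subr_ge0; apply; have := ltn_ord b; lia.
Qed.

Lemma theta_alpha : theta K n = alpha K n (@ord0 N).+1 (@ord_max N).
Proof. by []. Qed.

Lemma A0_le v a b : A0 v -> (a < b)%N -> V v /\ v 0 a - v 0 b <= 1.
Proof.
move=> /interior_subset[dom]; rewrite theta_alpha dot_alpha => v1 ab.
split; first by case: dom.
have := @dominant_le _ ord0 a dom (leq0n _).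
by have := @dominant_le _ b ord_max dom (leq_ord b); lra.
Qed.

(** This is the half-sum of the positive roots divided by [n]; the positive roots take the values
    [(b - a) / n] on it. *)
Definition A0_point : 'rV[K]_n := centered (fun k => k%:R / n%:R).

Lemma A0_pointB a b : (a < b)%N -> 0 < A0_point 0 a - A0_point 0 b < 1.
Proof.
move=> ab; rewrite centeredB -mulrBl -natrB; last exact: ltnW.
rewrite divr_gt0 ?ltr0n ?subn_gt0 //= ltr_pdivrMr ?ltr0n // mul1r ltr_nat.
by have := ltn_ord b; lia.
Qed.

(** Finitely many strict inequalities hold at the point, hence on an ambient neighbourhood, whose
    trace on [V] lies in the closed alcove. *)
Lemma A0_pointP : A0 A0_point.
Proof.
have Vx := centered_V (fun k => k%:R / n%:R) : V A0_point.
suff near0 : nbhs (A0_point : 'rV[K]_n) [set v : 'rV[K]_n |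
    forall ab : 'I_n * 'I_n, (ab.1 < ab.2)%N -> 0 < v 0 ab.1 - v 0 ab.2 < 1].
  rewrite /A0 /interior /= -[_ A0_point _]/(nbhs_subspace _ _).
  rewrite -nbhs_subspace_in //.
  apply: filterS near0 => v vP Vv /=.
  have vW a b : (a <= b)%N -> 0 <= v 0 a - v 0 b <= 1.
    rewrite leq_eqVlt => /orP[/eqP/val_inj->|ab];
      first by rewrite subrr lexx ler01.
    by have /andP[? ?] := vP (a, b) ab; rewrite !ltW.
  split; last first.
    by rewrite theta_alpha dot_alpha; case/andP: (vW ord0 ord_max (leq0n _)).
  split=> // i iP; have i1 : (i.-1 < n)%N by lia.
  have i2 : (i < n)%N by lia.
  have := dot_alpha v (Ordinal i1) (Ordinal i2); rewrite /= prednK; last by lia.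
  by move=> ->; have /andP[] := vW (Ordinal i1) (Ordinal i2) (leq_pred i).
apply: (@filter_forall _ ('I_n * 'I_n)%type (fun ab (v : 'rV[K]_n) =>
  (ab.1 < ab.2)%N -> 0 < v 0 ab.1 - v 0 ab.2 < 1) (nbhs (A0_point : 'rV[K]_n)) _)
  => -[a b] /=.
have [ab|ab] := boolP (a < b)%N; last by apply: nearW.
have [h0 h1] := andP (A0_pointB ab).
have c := @coordB_continuous K n a b A0_point.
have c0 : nbhs (A0_point : 'rV[K]_n) [set v : 'rV[K]_n | 0 < v 0 a - v 0 b] :=
  c _ (open_nbhs_nbhs (conj (@open_gt _ 0) h0)).
have c1 : nbhs (A0_point : 'rV[K]_n) [set v : 'rV[K]_n | v 0 a - v 0 b < 1] :=
  c _ (open_nbhs_nbhs (conj (@open_lt _ 1) h1)).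
by apply: filterS2 c0 c1 => v v0 v1 _; apply/andP.
Qed.

Lemma alcove_gt (A : set 'rV[K]_n) x v a b k : is_alcove A -> A x -> A v ->
  (a < b)%N -> (k%:~R < v 0 a - v 0 b) = (k%:~R < x 0 a - x 0 b).
Proof.
move=> /alcoveE[y offy ->]; rewrite componentE // => -[_ xy] [_ vy] ab.
by rewrite vy // xy.
Qed.

Lemma alcove_off (A : set 'rV[K]_n) : is_alcove A -> A `<=` off setT.
Proof. by move=> /alcoveE[y offy ->]; exact: connected_component_sub. Qed.

(** A positive root is positive on [A], at most 1 on [A0], and strictly between 0 and 1 at
    [A0_point]; this fixes the side of each alcove and excludes [k <= 0]. *)
Lemma separates_dominant (A : set 'rV[K]_n) x a b k : is_alcove A ->
    A `<=` dominant_chamber (n := n) -> A x -> (a < b)%N ->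
  separates (alpha K n a.+1 b) k A (@A0 K n) <->
  k%:~R < x 0 a - x 0 b /\ 1 <= k.
Proof.
move=> aA domA Ax ab; have offx := alcove_off aA Ax.
have [x00 x01] := andP (A0_pointB ab).
split=> [[[Ak A0k]|[Ak A0k]]|[kx k1]].
- have [_] := A0k _ A0_pointP; rewrite dot_alpha => k1.
  have [_] := Ak _ Ax; rewrite dot_alpha => xk.
  have k0 : k <= 0.
    have : k%:~R < (1 : K) by lra.
    by rewrite -[1](mulr1z 1) ltr_int; lia.
  have xb := dominant_le (domA _ Ax) (ltnW ab).
  have xn0 := offx.2 a b 0 ab I.
  have : (k%:~R : K) <= 0 by rewrite -[0](mulr0z 1) ler_int.
  by move=> k0'; case/eqP: xn0; rewrite mulr0z; lra.
- have [_] := A0k _ A0_pointP; rewrite dot_alpha => k1.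
  have [_] := Ak _ Ax; rewrite dot_alpha => xk.
  split; first by rewrite lt_neqAle xk andbT eq_sym; exact: offx.2.
  have : (0 : K) < k%:~R by lra.
  by rewrite -[0](mulr0z 1) ltr_int.
right; split=> v.
  move=> Av; split; first by case: (alcove_off aA Av).
  by rewrite dot_alpha ltW // (alcove_gt _ aA Ax Av).
move=> A0v; have [Vv v1] := A0_le A0v ab; split=> //.
by rewrite dot_alpha (le_trans v1) // -[1](mulr1z 1) ler_int.
Qed.

Lemma sep_hypsP (A : set 'rV[K]_n) x H : is_alcove A ->
    A `<=` dominant_chamber (n := n) -> A x ->
  sep_hyps A (@A0 K n) H <-> exists a b k,
    [/\ (a < b)%N, H = Hyp (alpha K n a.+1 b) k, k%:~R < x 0 a - x 0 b
      & 1 <= k].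
Proof.
move=> aA domA Ax; split.
  case=> r [k [/Delta_plusP[a [b [ab ->]]] -> sep]]; exists a, b, k.
  by have [? ?] := (separates_dominant k aA domA Ax ab).1 sep.
case=> a [b [k [ab -> kx k1]]]; exists (alpha K n a.+1 b), k; split=> //.
  by apply/Delta_plusP; exists a, b.
by apply/(separates_dominant k aA domA Ax ab).
Qed.

Lemma finite_sep_hyps (A : set 'rV[K]_n) x : is_alcove A ->
    A `<=` dominant_chamber (n := n) -> A x ->
  finite_set (sep_hyps A (@A0 K n)).
Proof.
move=> aA domA Ax.
(* A separating level is positive and below the value of its root at [x], so [B] bounds all of
   them. *)
pose B := (\max_(ab : 'I_n * 'I_n) (Num.truncn (x 0 ab.1 - x 0 ab.2)%R).+1)%N.
pose F (t : 'I_n * 'I_n * 'I_B) := Hyp (alpha K n t.1.1.+1 t.1.2) (t.2 : nat)%:Z.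
apply: (@sub_finite_set _ _ (F @` setT)); last first.
  by apply: finite_image; exact: finite_finset.
move=> H /(sep_hypsP _ aA domA Ax)[a [b [k [ab -> kx k1]]]].
case: k => // k in kx k1 *.
have kB : (k < B)%N.
  apply: leq_trans (leq_bigmax (a, b)) => /=.
  rewrite ltnS truncn_ge_nat //; first by rewrite ltW.
  by apply: ltW; apply: le_lt_trans kx; rewrite ler0z.
by exists ((a, b), Ordinal kB).
Qed.

(** Hyperplanes are counted as sets, so a second root and level presenting the same set must be
    excluded. The segment from [x] to [A0_point] would cross that set, yet the root of [a] and [b]
    stays below [k] along it. *)
Lemma Hyp_not_sep (A : set 'rV[K]_n) x a b k : is_alcove A ->
    A `<=` dominant_chamber (n := n) -> A x -> (a < b)%N -> 1 <= k ->
  x 0 a - x 0 b < k%:~R -> ~ sep_hyps A (@A0 K n) (Hyp (alpha K n a.+1 b) k).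
Proof.
move=> aA domA Ax ab k1 xk /(sep_hypsP _ aA domA Ax)[c [d [j [cd e jx j1]]]].
have [x0c xc1] := andP (A0_pointB cd); have [x0a xa1] := andP (A0_pointB ab).
have j1' : (1 : K) <= j%:~R by rewrite -[1](mulr1z 1) ler_int.
have k1' : (1 : K) <= k%:~R by rewrite -[1](mulr1z 1) ler_int.
have Vx : V x by case: (alcove_off aA Ax).
set X := x 0 c - x 0 d in jx; set Y := A0_point 0 c - A0_point 0 d in x0c xc1.
(* The parameter at which the segment reaches level [j]. *)
pose t := (X - j%:~R) / (X - Y).
have XY : 0 < X - Y by lra.
have t0 : 0 <= t by rewrite divr_ge0 //; lra.
have t1 : t <= 1 by rewrite ler_pdivrMr //; lra.
have : Hyp (alpha K n c.+1 d) j (seg x A0_point t).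
  split; first by apply: seg_V => //; exact: centered_V.
  rewrite dot_alpha segE -/X -/Y.
  have -> : (1 - t) * X + t * Y = X - t * (X - Y) by ring.
  by rewrite divfK ?gt_eqF //; ring.
rewrite -e => -[_]; rewrite dot_alpha segE => /eqP.
by rewrite lt_eqF //; apply: conv_lt => //; lra.
Qed.

(** Otherwise the separating hyperplanes of [A'] would form a proper subset of those of [A], against
    minimality. *)
Lemma minimal_alcove_le m (C A A' : set 'rV[K]_n) x x' a b k :
    dominant_region m C -> minimal_alcove C A -> A x ->
    is_alcove A' -> A' `<=` C -> A' x' ->
    (forall (c d : 'I_n) j, (c < d)%N -> j%:~R < x' 0 c - x' 0 d ->
       j%:~R < x 0 c - x 0 d) ->
  (a < b)%N -> k%:~R < x 0 a - x 0 b -> k%:~R < x' 0 a - x' 0 b.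
Proof.
move=> [_ domC] [aA AC minA] Ax aA' A'C A'x' le ab kx.
have dA := subset_trans AC domC; have dA' := subset_trans A'C domC.
rewrite ltNge; apply/negP => x'k.
have {}x'k : x' 0 a - x' 0 b < k%:~R.
  by rewrite lt_neqAle x'k andbT; exact: (alcove_off aA' A'x').2.
have k1 : 1 <= k.
  have x'0 := dominant_le (dA' _ A'x') (ltnW ab).
  have : (0 : K) < k%:~R by lra.
  by rewrite -[0](mulr0z 1) ltr_int.
apply: (card_le_proper _ _ _ _ (minA _ aA' A'C)).
- exact: finite_sep_hyps A'x'.
- move=> H /(sep_hypsP _ aA' dA' A'x')[c [d [j [cd -> jx' j1]]]].
  by apply/(sep_hypsP _ aA dA Ax); exists c, d, j; split=> //; exact: le.
- by apply/(sep_hypsP _ aA dA Ax); exists a, b, k.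
- exact: Hyp_not_sep x'k.
Qed.

End Geometry.

(** * Affine dimension *)

(** The [d] independent differences are orthogonal to the [e] independent rows of [W], so the ranks
    add up to at most [n]. *)
Lemma aff_indep_codim (K : realType) (n d e : nat) (x : 'I_d.+1 -> 'rV[K]_n)
    (W : 'M[K]_(e, n)) :
  aff_indep x -> row_free W -> (forall i, (x i - x ord0) *m W^T = 0) ->
  (d + e <= n)%N.
Proof.
rewrite /aff_indep /row_free => /eqP rx /eqP rW xW.
rewrite -{1}rx -{1}rW -(mxrank_tr W); apply: mulmx0_rank_max.
by apply/row_matrixP => i; rewrite row_mul rowK row0 xW.
Qed.

Lemma aff_indep_dot (K : realType) (n d : nat) (x : 'I_d.+1 -> 'rV[K]_n)
    (s : seq 'rV[K]_n) :
  aff_indep x -> row_free (\matrix_(j < size s) s`_j) ->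
  (forall i w, w \in s -> dot (x i) w = dot (x ord0) w) -> (d + size s <= n)%N.
Proof.
move=> ax fs xs; apply: (aff_indep_codim ax fs) => i.
apply/rowP => j; rewrite !mxE.
transitivity (dot (x i) s`_j - dot (x ord0) s`_j).
  by rewrite /dot -sumrB; apply: eq_bigr => k _; rewrite !mxE mulrBl.
by rewrite xs ?subrr //; apply: mem_nth.
Qed.

Lemma alphaE (K : realType) n (a b k : 'I_n) :
  alpha K n a.+1 b 0 k = (k == a)%:R - (k == b)%:R.
Proof. by rewrite !mxE !eqSS. Qed.

Lemma dot_ones (K : realType) n (v : 'rV[K]_n) : V v -> dot v (const_mx 1) = 0.
Proof. by move=> Vv; rewrite -[RHS]Vv; apply: eq_bigr => k _; rewrite mxE mulr1. Qed.

Lemma row_free_seq (K : realType) n (s : seq 'rV[K]_n) :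
  (forall f : nat -> K, (forall k, \sum_(0 <= j < size s) f j * s`_j 0 k = 0) ->
     forall j, (j < size s)%N -> f j = 0) ->
  row_free (\matrix_(j < size s) s`_j).
Proof.
move=> sP; apply: inj_row_free => v v0; apply/rowP => i; rewrite [RHS]mxE.
pose f j := if insub j is Some i then v 0 i else 0.
have fE (j : 'I_(size s)) : f j = v 0 j by rewrite /f valK.
rewrite -fE; apply: sP => // k; rewrite big_mkord.
have := congr1 (fun M : 'rV[K]_n => M 0 k) v0; rewrite !mxE => e.
by rewrite -[RHS]e; apply: eq_bigr => j _; rewrite fE !mxE.
Qed.

Lemma row_free_ones_alpha (K : realType) N :
  row_free (\matrix_(j < 2)
    [:: const_mx 1; alpha K N.+2 (@ord0 N.+1).+1 (@ord_max N.+1)]`_j).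
Proof.
apply: (@row_free_seq _ _
  [:: const_mx 1; alpha K N.+2 (@ord0 N.+1).+1 (@ord_max N.+1)]).
have := alphaE K (@ord0 N.+1) ord_max; set al := alpha _ _ _ _ => alE.
move=> f fk; have := fk ord0; have := fk ord_max.
rewrite /= !big_nat_recl // !big_geq //= !alE !mxE !eqxx /= => h1 h2.
have f0 : f 0%N = 0 by lra.
have f1 : f 1%N = 0 by lra.
by case=> [|[|]].
Qed.

(** Three independent constraints: points of [V] on which [theta] and one further root are constant
    span too small a dimension for a facet. *)
Lemma row_free_ones_alpha2 (K : realType) N (u : 'I_N.+2) :
  u != ord0 -> u != ord_max ->
  row_free (\matrix_(j < 3)
    [:: const_mx 1; alpha K N.+2 (@ord0 N.+1).+1 (@ord_max N.+1);
        alpha K N.+2 (@ord0 N.+1).+1 u]`_j).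
Proof.
move=> u0 um; apply: (@row_free_seq _ _ [:: const_mx 1;
  alpha K N.+2 (@ord0 N.+1).+1 (@ord_max N.+1); alpha K N.+2 (@ord0 N.+1).+1 u]).
have := alphaE K (@ord0 N.+1) u; have := alphaE K (@ord0 N.+1) ord_max.
set al := alpha _ _ _ ord_max; set be := alpha _ _ _ u => alE beE.
move=> f fk; have := fk ord0; have := fk ord_max; have := fk u.
rewrite /= !big_nat_recl // !big_geq //= !alE !beE !mxE !eqxx /=.
rewrite (negbTE u0) (negbTE um) ![_ == u]eq_sym (negbTE u0) (negbTE um) /=.
move=> h1 h2 h3.
have f0 : f 0%N = 0 by lra.
have f1 : f 1%N = 0 by lra.
have f2 : f 2%N = 0 by lra.
by case=> [|[|[|]]].
Qed.

(** * The cell of a window *)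

Section Cell.
Variables (K : realType) (N : nat).
Local Notation n := N.+1.
Variables (c : 'I_n -> int) (rk : 'I_n -> nat).
Hypothesis rk_inj : injective rk.
Hypothesis rk_lt : forall a, (rk a < n)%N.
Implicit Types (v x : 'rV[K]_n) (a b : 'I_n) (k : int).

(** For the window [p a = n (c a) + rk a], this gives [v 0 a - v 0 b] the same floor as
    [(p b - p a) / n]. Ordering pairs by rank avoids a correction by 1. *)
Definition incell v := V v /\ forall a b, (rk a < rk b)%N ->
  (c b - c a)%:~R < v 0 a - v 0 b < (c b - c a)%:~R + 1.

(** The floor of [(p b - p a) / n] for arbitrary [a] and [b], with the borrow when the ranks
    decrease. *)
Definition cell_floor a b : int := c b - c a - (rk b < rk a)%N%:Z.

Lemma incell_floor v a b : incell v -> a != b ->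
  (cell_floor a b)%:~R < v 0 a - v 0 b < (cell_floor a b)%:~R + 1.
Proof.
move=> [_ vP] ab; rewrite /cell_floor.
have rab : rk a != rk b by rewrite (inj_eq rk_inj).
have [lt|lt|e] := ltngtP (rk a) (rk b).
- by rewrite subr0; exact: vP.
- have /andP[v0 v1] := vP _ _ lt; move: v0 v1; rewrite !rmorphB /= mulr1z => v0 v1.
  by apply/andP; split; lra.
- by rewrite e eqxx in rab.
Qed.

Lemma incell_gt v a b k : incell v -> (a < b)%N ->
  (k%:~R < v 0 a - v 0 b) = (k <= cell_floor a b).
Proof.
move=> vc ab; apply: unit_itv_lt; apply: incell_floor => //.
by apply: contraTneq ab => ->; rewrite ltnn.
Qed.

Lemma incell_off v : incell v -> off setT v.
Proof.
move=> vc; split; first by case: vc.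
move=> a b k ab _; apply: (@unit_itv_neq _ _ (cell_floor a b)).
by apply: incell_floor => //; apply: contraTneq ab => ->; rewrite ltnn.
Qed.

(** The centred point comes from the window divided by [n], and rank differences are less than
    [n]. *)
Lemma incell_centered : incell (centered (fun e => (c e)%:~R + (rk e)%:R / n%:R)).
Proof.
split; first exact: centered_V.
move=> a b ab; rewrite centeredB rmorphB /=.
set ca : K := (c a)%:~R; set cb : K := (c b)%:~R.
have -> : cb + (rk b)%:R / n%:R - (ca + (rk a)%:R / n%:R) =
  cb - ca + ((rk b)%:R - (rk a)%:R) / n%:R by ring.
have d0 : 0 < ((rk b)%:R - (rk a)%:R : K) / n%:R.
  by rewrite divr_gt0 ?ltr0n // subr_gt0 ltr_nat.
have d1 : ((rk b)%:R - (rk a)%:R : K) / n%:R < 1.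
  rewrite ltr_pdivrMr ?ltr0n // mul1r ltrBlDr -natrD ltr_nat.
  by have := rk_lt b; lia.
by rewrite ltrDl d0 ltrD2l.
Qed.

Lemma rk_surj s : (s < n)%N -> exists a, rk a = s.
Proof.
move=> sn; pose f a : 'I_n := Ordinal (rk_lt a).
have f_inj : injective f by move=> a b [] /rk_inj.
have [g _ fg] := injF_bij f_inj; exists (g (Ordinal sn)).
by have /(congr1 val) := fg (Ordinal sn).
Qed.

End Cell.

(** * Inequalities valid on the whole region *)

Section Region.
Variables (K : realType) (N m : nat).
Local Notation n := N.+2.
Hypothesis m_gt0 : (0 < m)%N.
Variables (c : 'I_n -> int) (rk : 'I_n -> nat).
Hypothesis rk_inj : injective rk.
Hypothesis rk_lt : forall a, (rk a < n)%N.
(** Monotonicity of the window, expressed by quotients and remainders. *)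
Hypothesis c_mono : forall a b : 'I_n, (a < b)%N ->
  c a < c b \/ c a = c b /\ (rk a < rk b)%N.
Hypothesis rk0 : rk ord0 = 0%N.
Hypothesis c0 : c ord0 = 0.
Variables (C A : set 'rV[K]_n) (x : 'rV[K]_n).
Hypothesis domC : dominant_region m C.
Hypothesis minA : minimal_alcove C A.
Hypothesis Ax : A x.
Hypothesis xc : incell c rk x.
Implicit Types (v : 'rV[K]_n) (a b : 'I_n) (k : int).

Local Notation fl := (cell_floor c rk).

Lemma regionE : C = connected_component (off (shi_range m)) x.
Proof.
have [/region_off[y offy CE] _] := domC; have [_ AC _] := minA.
by have := AC _ Ax; rewrite CE => /same_connected_component.
Qed.

Lemma x_off_shi : off (shi_range m) x.
Proof. by have [Vx xP] := incell_off rk_inj xc; split=> // a b k ab _; exact: xP. Qed.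

Lemma regionP v : C v <-> off (shi_range m) v /\ forall a b k, (a < b)%N ->
  shi_range m k -> (k%:~R < v 0 a - v 0 b) = (k <= fl a b).
Proof.
rewrite regionE componentE; last exact: x_off_shi.
split=> -[offv vP]; split=> // a b k ab kP; first by rewrite vP // (incell_gt _ _ xc).
by rewrite vP // (incell_gt _ _ xc).
Qed.

Lemma incell_region v : incell c rk v -> C v.
Proof.
move=> vc; apply/regionP; split; last by move=> a b k ab _; exact: incell_gt.
by have [Vv vP] := incell_off rk_inj vc; split=> // a b k ab _; exact: vP.
Qed.

Lemma region_rank v a b : C v -> (rk a < rk b)%N ->
  - m%:Z <= c b - c a <= m%:Z -> (c b - c a)%:~R < v 0 a - v 0 b.
Proof.
move=> /regionP[offv vP] rab cab; have [ab|ba|/val_inj ab] := ltngtP a b.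
- have := c_mono ab => cm; rewrite vP // /cell_floor; last by rewrite /shi_range /=; lia.
  lia.
(* Since [rk a < rk b], monotonicity gives [c b < c a]. The level [c a - c b] is one above the floor
   for [b] and [a], so it bounds that root from above. *)
- have cm := c_mono ba; have kP : shi_range m (c a - c b) by rewrite /shi_range /=; lia.
  have := vP b a _ ba kP; rewrite /cell_floor rab /=.
  have -> : (c a - c b <= c a - c b - 1) = false by lia.
  move/negbT; rewrite -leNgt => le.
  have : v 0 b - v 0 a < (c a - c b)%:~R.
    by rewrite lt_neqAle le andbT; exact: offv.2.
  by rewrite !rmorphB /=; lra.
- by rewrite ab ltnn in rab.
Qed.

(* Otherwise the wall of [A] between the ranks [rk a] and [rk b] would not be a
   hyperplane of the arrangement, and crossing it towards the origin would stay
   in the region. *)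
Lemma adjacent_le a b : rk b = (rk a).+1 -> c b - c a <= m%:Z.
Proof.
move=> rab; rewrite leNgt; apply/negP => mk.
have ab : (a < b)%N.
  have [//|ba|/val_inj e] := ltngtP a b; first by have := c_mono ba; lia.
  by rewrite e in rab; lia.
(* Exchanging two consecutive ranks crosses only the wall [v 0 a - v 0 b = c b - c a]; every other
   floor is unchanged. *)
pose rk' e := rk (tperm a b e).
have rk'_inj : injective rk' by apply: inj_comp => //; exact: perm_inj.
have rk'_lt e : (rk' e < n)%N by exact: rk_lt.
have x'c := @incell_centered K _ c rk' rk'_lt; set x' := centered _ in x'c.
have flE (e f : 'I_n) : (e < f)%N -> cell_floor c rk' e f =
    if (e == a) && (f == b) then fl a b - 1 else fl e f.
  move=> ef; have fe : e != f by apply: contraTneq ef => ->; rewrite ltnn.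
  have ne (g h : 'I_n) : g != h -> rk g != rk h by rewrite (inj_eq rk_inj).
  rewrite /cell_floor /rk'.
  have [ea|ea] := eqVneq e a; have [fb|fb] := eqVneq f b.
  - by rewrite ea fb tpermL tpermR rab /=; lia.
  - rewrite ea tpermL tpermD /=; [|by rewrite -ea|by rewrite eq_sym].
    have := ne _ _ fb; have := ne _ _ fe; rewrite ea; lia.
  - rewrite fb tpermR tpermD /=; [|by rewrite eq_sym|by rewrite eq_sym -fb].
    have := ne _ _ ea; have := ne _ _ fe; rewrite fb; lia.
  - have [eb|eb] := eqVneq e b; have [fa|fa] := eqVneq f a.
    + by move: ef; rewrite eb fa; lia.
    + rewrite eb tpermR tpermD /=; [|by rewrite eq_sym|by rewrite eq_sym].
      have := ne _ _ fa; have := ne _ _ fb; lia.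
    + rewrite fa tpermL tpermD /=; [|by rewrite eq_sym|by rewrite eq_sym].
      have := ne _ _ ea; have := ne _ _ eb; lia.
    + by rewrite !tpermD // eq_sym.
have flab : fl a b = c b - c a by rewrite /cell_floor rab; lia.
have offx' := incell_off rk'_inj x'c.
(* The crossed level exceeds [m], so it is not a Shi level. *)
have Cx' : C x'.
  apply/regionP; split=> [|e f k ef /andP[_ km]].
    by split=> [|e f k ef _]; [case: offx'|exact: offx'.2].
  rewrite (incell_gt rk'_inj _ x'c) // flE //; case: ifP => // /andP[/eqP-> /eqP->].
  by rewrite flab; lia.
pose A' := connected_component (off setT) x'.
have aA' : is_alcove A' by apply/alcoveE; exists x'.
have A'x' : A' x' by exact: connected_component_refl.
have A'C : A' `<=` C.
  move=> v; rewrite /A' componentE // => -[offv vP]; apply/regionP.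
  split=> [|e f k ef kP]; first by split=> [|e f k ef _]; [case: offv|exact: offv.2].
  by rewrite vP //; move/regionP: Cx' => -[_]; apply.
(* Minimality of [A] keeps [x'] beyond this level, but its floor there has dropped by one. *)
have : (c b - c a)%:~R < x' 0 a - x' 0 b.
  apply: (minimal_alcove_le domC minA Ax aA' A'C A'x' _ ab).
    move=> e f j ef; rewrite (incell_gt rk'_inj _ x'c) //.
    rewrite (incell_gt rk_inj _ xc) // flE //.
    by case: ifP => // /andP[/eqP-> /eqP->]; lia.
  by rewrite (incell_gt rk_inj _ xc) // flab.
by rewrite (incell_gt rk'_inj _ x'c) // flE // !eqxx /= flab; lia.
Qed.

Lemma c_ge0 a : 0 <= c a.
Proof.
have [->|a0] := eqVneq a ord0; first by rewrite c0.
have a1 : (@ord0 n.-1 < a)%N.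
  by rewrite lt0n; apply: contra a0 => /eqP e; apply/eqP/val_inj.
by have := c_mono a1; rewrite c0; lia.
Qed.

Lemma c_le_max a : c a <= c ord_max.
Proof.
have [->//|am] := eqVneq a ord_max.
have a1 : (a < @ord_max n.-1)%N.
  rewrite ltn_neqAle leq_ord andbT; apply: contra am => /eqP e; exact/eqP/val_inj.
by have [/ltW//|[->]] := c_mono a1.
Qed.

Lemma rk_max_gt0 : (0 < rk ord_max)%N.
Proof.
rewrite lt0n -rk0 (inj_eq rk_inj); exact/eqP.
Qed.

(* Passing from [a] to an element of minimal [c] among those of rank in
   ]rk a, rk ord_max] raises [c] by at most [m], by [adjacent_le]. *)
Lemma region_chain v a : C v -> (rk a < rk ord_max)%N ->
  (forall b, (rk a < rk b <= rk ord_max)%N -> c a <= c b) ->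
  (c ord_max - c a)%:~R < v 0 a - v 0 ord_max.
Proof.
move=> Cv; have [d] := ubnP (rk ord_max - rk a)%N.
elim: d a => // d IHd a ad ra amin.
have [s rs] : exists s, rk s = (rk a).+1.
  by apply: (rk_surj rk_inj rk_lt); have := rk_lt ord_max; lia.
pose P b := (rk a < rk b <= rk ord_max)%N.
have Ps : P s by rewrite /P rs; lia.
case: (@arg_minP _ _ _ s P c Ps) => b Pb bmin.
have bs := bmin _ Ps; have sa := adjacent_le rs; have ab := amin _ Pb.
have [ra' rb'] := andP Pb.
have h1 : (c b - c a)%:~R < v 0 a - v 0 b.
  by apply: region_rank => //; lia.
have [bm|bm] := eqVneq (rk b) (rk ord_max); first by rewrite -(rk_inj bm).
(* The minimality of [c b] on the larger range of ranks supplies the hypothesis for [b]. *)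
have h2 : (c ord_max - c b)%:~R < v 0 b - v 0 ord_max.
  apply: IHd; [lia|lia|].
  by move=> e eP; apply: bmin; rewrite /P; lia.
by move: h1 h2; rewrite !rmorphB /=; lra.
Qed.

Lemma region_theta v : C v -> (c ord_max)%:~R < v 0 ord0 - v 0 ord_max.
Proof.
move=> Cv; rewrite -[c ord_max]subr0 -c0; apply: region_chain => //.
  by rewrite rk0 rk_max_gt0.
by move=> b _; rewrite c0 c_ge0.
Qed.

(** * The wall [theta = m], in both directions *)

Lemma wall_last : separating_wall m C (theta K n) m%:Z ->
  c ord_max = m%:Z /\ rk ord_max = 1%N.
Proof.
case=> [[_ _ [_ [[z zP az] _]]]] sep.
(* [A0_point] has [theta < 1 <= m], so the region is on the upper side. *)
have Cge v : C v -> m%:Z%:~R <= v 0 ord0 - v 0 ord_max.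
  case: sep => [[_ A0m]|[Cm _]].
    have [_] := A0m _ (A0_pointP K n.-1); rewrite theta_alpha dot_alpha => m1.
    have /andP[_ x01] := @A0_pointB K n.-1 ord0 ord_max isT.
    have : (1 : K) <= m%:Z%:~R by rewrite -[1](mulr1z 1) ler_int; lia.
    lra.
  by move=> /Cm[_]; rewrite theta_alpha dot_alpha.
have zV i : V (z i) by case: (zP i) => _ [].
have zm i : z i 0 ord0 - z i 0 ord_max = m%:Z%:~R.
  by case: (zP i) => _ [_]; rewrite theta_alpha dot_alpha.
have zcl i : closure C (z i) by case: (zP i).
have mc : m%:Z <= c ord_max.
  have Cx : C x by case: minA => _ sAC _; exact: sAC.
  have := xc.2 ord0 ord_max; rewrite c0 subr0 rk0 => /(_ rk_max_gt0)/andP[_ xlt].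
  have := le_lt_trans (Cge _ Cx) xlt.
  by rewrite -[1](mulr1z 1) -intrD ltr_int; lia.
have cm : c ord_max <= m%:Z.
  rewrite -(ler_int K) -(zm ord0); apply: closure_ge (zcl ord0) => v Cv.
  by apply: ltW; exact: region_theta.
have {mc} cm : c ord_max = m%:Z by apply/eqP; rewrite eq_le cm mc.
split=> //; apply/eqP; rewrite eqn_leq rk_max_gt0 andbT leqNgt; apply/negP => r2.
have [u ru] : exists u, rk u = 1%N by exact: (rk_surj rk_inj rk_lt).
have u0 : u != ord0 by apply: contra_eqN ru => /eqP ->; rewrite rk0.
have um : u != ord_max by apply: contraTneq r2 => <-; rewrite ru.
have cu0 := c_ge0 u; have cum := c_le_max u.
(* The two lower bounds add up to [m], the value of [theta] at [z i], so both are equalities. *)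
have zu i : z i 0 ord0 - z i 0 u = (c u)%:~R.
  have h1 : (c u - c ord0)%:~R <= z i 0 ord0 - z i 0 u.
    apply: closure_ge (zcl i) => v Cv; apply: ltW; apply: region_rank => //.
      by rewrite rk0 ru.
    by rewrite c0; lia.
  have h2 : (c ord_max - c u)%:~R <= z i 0 u - z i 0 ord_max.
    apply: closure_ge (zcl i) => v Cv; apply: ltW; apply: region_rank => //.
      by rewrite ru.
    by lia.
  move: h1 h2 (zm i); rewrite c0 cm !rmorphB /= mulr0z; lra.
(* A facet would have dimension [n - 2], but three independent constraints leave at most [n - 3]. *)
have := aff_indep_dot (s := [:: _; _; _]) az (row_free_ones_alpha2 K u0 um).
suff H i w : w \in [:: const_mx 1; alpha K n (@ord0 n.-1).+1 (@ord_max n.-1);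
    alpha K n (@ord0 n.-1).+1 u] -> dot (z i) w = dot (z ord0) w.
  by move/(_ H) => /=; lia.
rewrite !inE => /or3P[] /eqP ->; rewrite ?dot_alpha ?zm ?zu //.
by rewrite !dot_ones ?zV.
Qed.

(** The half-open segment from [x] stays in the open cell: only lower bounds can become equalities,
    and only at its end. *)
Lemma facet_point_closure (f : 'I_n -> K) :
  (forall a b, (rk a < rk b)%N -> 0 <= f b - f a < 1) ->
  closure C (centered (fun e => (c e)%:~R + f e)).
Proof.
move=> fP; apply: (@closure_seg _ _ _ x) => t /andP[t0 t1].
apply: incell_region; split.
  by apply: seg_V; [case: xc|exact: centered_V].
move=> a b rab; rewrite segE centeredB.
have /andP[f0 f1] := fP _ _ rab; have /andP[x0 x1] := xc.2 _ _ rab.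
set Y := _ + f b - _; set k : K := _%:~R in x0 x1 *.
have Y0 : 0 <= Y - k by rewrite /Y /k rmorphB /=; lra.
have Y1 : Y < k + 1 by rewrite /Y /k rmorphB /=; lra.
apply/andP; split; last by apply: conv_lt => //; exact: ltW.
have : 0 < (1 - t) * (x 0 a - x 0 b - k) by rewrite mulr_gt0 // subr_gt0.
have : 0 <= t * (Y - k) by rewrite mulr_ge0.
lra.
Qed.

(* Ranks are scaled by [4]: the common value [2] at both ends of [theta] lies
   strictly between their ranks [0] and [1], and adding [1] at one other
   element, which gives the independent directions, does not change the order. *)
Definition facet_height (i : 'I_N.+1) (e : 'I_n) : nat :=
  if (e == ord0) || (e == ord_max) then 2%N else (4 * rk e + (e == i :> nat))%N.

(** Division by [4 * n] brings the differences of heights below 1. *)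
Definition facet_point (i : 'I_N.+1) : 'rV[K]_n :=
  centered (fun e => (c e)%:~R + (facet_height i e)%:R / (4 * n)%:R).

Lemma facet_pointB i a b : facet_point i 0 a - facet_point i 0 b =
  (c b - c a)%:~R + ((facet_height i b)%:R - (facet_height i a)%:R) / (4 * n)%:R.
Proof. by rewrite centeredB rmorphB /=; ring. Qed.

(** Index 0 is an end of [theta], where nothing is raised, so it gives the base point; each other
    index raises one middle element alone. *)
Lemma aff_indep_facet_point : aff_indep facet_point.
Proof.
apply: inj_row_free => v v0; apply/rowP => j; rewrite [RHS]mxE.
have vk (k : 'I_n) : \sum_(i < N) v 0 i *
    (facet_point (lift ord0 i) 0 k - facet_point ord0 0 k) = 0.
  have := congr1 (fun M : 'rV[K]_n => M 0 k) v0; rewrite !mxE => e.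
  by rewrite -[RHS]e; apply: eq_bigr => i _; rewrite !mxE.
have jn : (j.+1 < n)%N by have := ltn_ord j; lia.
pose k : 'I_n := Ordinal jn.
have kmid : (k == ord0) || (k == ord_max) = false.
  by apply/negbTE; rewrite negb_or -!val_eqE /=; have := ltn_ord j; lia.
(* Subtracting the relations at coordinates [ord0] and [k] cancels the centring and isolates
   [v 0 j]. *)
have : \sum_(i < N) v 0 i * ((i == j)%:R / (4 * n)%:R) = 0.
  rewrite -[RHS](subrr (0 : K)) -[X in _ = X - _](vk ord0) -[X in _ = _ - X](vk k).
  rewrite -sumrB; apply: eq_bigr => i _.
  rewrite -mulrBr; congr (_ * _).
  have h1 := facet_pointB (lift ord0 i) ord0 k.
  have h2 := facet_pointB ord0 ord0 k.
  move: h1 h2; rewrite /facet_height eqxx kmid /= /bump /= !eqSS eq_sym addn0 natrD.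
  set d : K := (4 * n)%:R^-1.
  rewrite (_ : (i == j :> nat) = (i == j)) // => h1 h2.
  by move: h1 h2; rewrite !mulrBl mulrDl; lra.
rewrite (bigD1 j) //= eqxx big1 ?addr0; last by move=> i /negbTE ->; rewrite mul0r mulr0.
move/eqP; rewrite mul1r mulf_eq0 invr_eq0 pnatr_eq0 /= orbF => /eqP //.
Qed.

Lemma last_wall : c ord_max = m%:Z -> rk ord_max = 1%N ->
  separating_wall m C (theta K n) m%:Z.
Proof.
move=> cm rm.
have CV v : C v -> V v by move=> /regionP[[]].
have Cge : C `<=` half_ge (theta K n) m%:Z.
  move=> v Cv; split; first exact: CV.
  by rewrite theta_alpha dot_alpha ltW // -cm; exact: region_theta.
split; last first.
  right; split=> // v A0v; have [Vv v1] := A0_le (a := ord0) (b := ord_max) A0v isT.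
  split=> //; rewrite theta_alpha dot_alpha (le_trans v1) //.
  by rewrite -[1](mulr1z 1) ler_int; lia.
split; [by rewrite theta_alpha; apply/Delta_plusP; exists ord0, ord_max|lia|].
split; first by right.
split; last first.
  (* The equations of [V] and of [theta = m] bound the dimension by [n - 2]. *)
  case=> z zP az; have := aff_indep_dot (s := [:: _; _]) az (row_free_ones_alpha K N).
  suff H i w : w \in [:: const_mx 1; alpha K n (@ord0 n.-1).+1 (@ord_max n.-1)] ->
      dot (z i) w = dot (z ord0) w.
    by move/(_ H) => /=; lia.
  rewrite !inE => /orP[] /eqP ->.
    by rewrite !dot_ones //; case: (zP i) => _ []; case: (zP ord0) => _ [].
  by case: (zP i) => _ [_]; case: (zP ord0) => _ [_]; rewrite theta_alpha => -> ->.
exists facet_point; last exact: aff_indep_facet_point.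
move=> i; split; last first.
  split; first exact: centered_V.
  rewrite theta_alpha dot_alpha facet_pointB /facet_height !eqxx orbT subrr mul0r.
  by rewrite addr0 c0 subr0 cm.
apply: facet_point_closure => a b rab; rewrite -mulrBl.
have rb := rk_lt b.
have am : a == ord_max -> rk a = 1%N by move/eqP->.
have bm : b == ord_max -> rk b = 1%N by move/eqP->.
have b0 : b == ord0 -> rk b = 0%N by move/eqP->.
have a0 : (rk a == 0)%N -> a == ord0 by rewrite -rk0 (inj_eq rk_inj).
have b1 : (rk b == 1)%N -> b == ord_max by rewrite -rm (inj_eq rk_inj).
(* Ranks 0 and 1 belong to the two ends, both of height 2; the other ranks have heights from 8 to
   [4 * n - 3]. *)
have [Q1 Q2] : (facet_height i a <= facet_height i b)%N /\
    (facet_height i b < facet_height i a + 4 * n)%N.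
  by rewrite /facet_height;
    case: (a == ord0) (a == ord_max) (b == ord0) (b == ord_max) am bm b0 a0 b1 => [] [] [] [] /= am bm b0 a0 b1; lia.
rewrite divr_ge0 ?subr_ge0 ?ler_nat ?ler0n //= ltr_pdivrMr ?ltr0n //.
by rewrite mul1r ltrBlDr -natrD ltr_nat addnC.
Qed.

End Region.

(** * From the window of the core to the cell of the alcove *)

Theorem theorem3p1 (K : realType) (n m : nat) (hn : (2 <= n)%N)
    (hm : (1 <= m)%N) (C A : set 'rV[K]_n) (la : seq nat)
    (hC : dominant_region m C) (hA : minimal_alcove C A)
    (hla : is_core n la) (hPsi : Psi_eq la A) :
  separating_wall m C (theta K n) m%:Z
  <-> hook la 1 1 = (n * (m - 1) + 1)%N.
Proof.
rewrite -(nth_pseq_last_hook hn hla hm).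
case: n hn C A hC hA hla hPsi => [|[|N]] // hn C A hC hA hla [aA hPsi].
set n := N.+2; pose p (a : 'I_n) : int := nth 0 (pseq n la) a.
pose c a := (p a %/ n%:Z)%Z; pose rk a := `|(p a %% n%:Z)%Z|%N.
have rkE a : (rk a)%:Z = (p a %% n%:Z)%Z.
  by rewrite /rk gez0_abs // modz_ge0.
have rk_lt a : (rk a < n)%N by rewrite -ltz_nat rkE ltz_pmod.
have pE a : p a = c a * n%:Z + (rk a)%:Z by rewrite rkE -divz_eq.
have rk_inj : injective rk.
  move=> a b rab; apply/val_inj; apply: (@nth_pseq_mod_inj n la hn); try exact: ltn_ord.
  by rewrite -[nth _ _ _]/(p a) -[nth _ _ (val b)]/(p b) -!rkE rab.
have p_lt (a b : 'I_n) : (a < b)%N -> p a < p b.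
  by move=> ab; apply: nth_pseq_lt => //; rewrite ab ltn_ord.
have c_mono (a b : 'I_n) : (a < b)%N -> c a < c b \/ c a = c b /\ (rk a < rk b)%N.
  move=> /p_lt; rewrite !pE; have := rk_lt a; have := rk_lt b.
  have [|ba|->] := ltgtP (c a) (c b); [by left| |right; lia].
  by nia.
have p0 : p ord0 = 0 by exact: nth_pseq0.
have c0 : c ord0 = 0 by rewrite /c p0 div0z.
have rk0 : rk ord0 = 0%N by rewrite /rk p0 mod0z.
have [x Ax] : exists x, A x.
  by have /alcoveE[x offx ->] := aA; exists x; exact: connected_component_refl.
(* When index and rank order disagree, the Shi coordinate is [c a - c b - 1]; negating its interval
   gives the one required for [a] and [b]. *)
have xc : incell c rk x.
  split=> [|a b rab]; first by case: (alcove_off aA Ax).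
  have rb := rk_lt b.
  have [ab|ba|/val_inj ab] := ltngtP a b; last by rewrite ab ltnn in rab.
    have := hPsi a.+1 b _ x Ax; rewrite dot_alpha.
    have -> : Psi_coords n la a.+1 b = c b - c a.
      apply: (@divz_quot _ _ ((rk b)%:Z - (rk a)%:Z)); first lia.
      by rewrite -[psorted _ _ _]/(p b) -[psorted _ _ a.+1]/(p a) !pE; ring.
    by apply; have := ltn_ord b; lia.
  have := hPsi b.+1 a _ x Ax; rewrite dot_alpha.
  have -> : Psi_coords n la b.+1 a = c a - c b - 1.
    apply: (@divz_quot _ _ (n%:Z - ((rk b)%:Z - (rk a)%:Z))); first lia.
    by rewrite -[psorted _ _ _]/(p a) -[psorted _ _ b.+1]/(p b) !pE; ring.
  move=> /(_ _)/andP[|]; first by have := ltn_ord a; lia.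
  rewrite !rmorphB /= mulr1z => x0 x1.
  by apply/andP; split; lra.
have -> : nth 0 (pseq n la) n.-1 = c ord_max * n%:Z + (rk ord_max)%:Z.
  by rewrite -pE.
split.
  case/(wall_last hm rk_inj rk_lt c_mono rk0 c0 hC hA Ax xc) => -> ->; lia.
move=> e; have rm := rk_lt ord_max.
(* As [1 < n], division of [n * m + 1] by [n] has quotient [m] and remainder 1. *)
have cm : c ord_max = m%:Z by nia.
apply: (last_wall hm rk_inj rk_lt c_mono rk0 c0 hC hA Ax xc) => //.
by move: e; rewrite cm; lia.
Qed.
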